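(* There are Martin-Löf tests $\mathcal U=(\mathcal U_i)_{i\in\omega}$ and $\mathcal V=(\mathcal V_i)_{i\in\omega}$ such that $\mathcal U$ is universal but there exists $i\in\omega$ such that for all $j\in\omega$, $\mathcal V_j\not\subseteq\mathcal U_i$.
   Context: Work in Cantor space $2^\omega$ with Lebesgue measure $\lambda$. For $\sigma\in 2^{<\omega}$, $[\sigma]=\{X\in 2^\omega:\sigma\prec X\}$. A sequence $(\mathcal U_i)_{i\in\omega}$ of open subsets of $2^\omega$ is uniformly effectively open if $\{\langle i,\sigma\rangle : [\sigma]\subseteq\mathcal U_i\}$ is computably enumerable. A Martin-Löf (ML) test is a uniformly effectively open sequence $(\mathcal V_i)_{i\in\omega}$ with $\lambda(\mathcal V_i)\le 2^{-i}$ for all $i$. An ML-test $\mathcal U$ is universal if $\bigcap_i\mathcal V_i\subseteq\bigcap_i\mathcal U_i$ for every ML-test $\mathcal V$. *)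

(* Defs.v *)
From mathcomp Require Import all_boot all_order all_algebra.
Set Implicit Arguments. Unset Strict Implicit. Unset Printing Implicit Defensive.
Import Order.TTheory GRing.Theory Num.Theory.

Inductive prf : Type :=
  | PZero : prf
  | PSucc : prf
  | PProj : nat -> prf
  | PComp : prf -> list prf -> prf
  | PPrec : prf -> prf -> prf
  | PMu   : prf -> prf.

Inductive peval : prf -> seq nat -> nat -> Prop :=
  | ev_zero v : peval PZero v 0
  | ev_succ v : peval PSucc v (nth 0 v 0).+1
  | ev_proj i v : peval (PProj i) v (nth 0 v i)
  | ev_comp f gs v ys y :
      pevals gs v ys -> peval f ys y -> peval (PComp f gs) v y
  | ev_prec0 f g v y : peval f v y -> peval (PPrec f g) (0 :: v) y
  | ev_precS f g n v z y :
      peval (PPrec f g) (n :: v) z -> peval g (n :: z :: v) y ->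
      peval (PPrec f g) (n.+1 :: v) y
  | ev_mu f v n :
      peval f (n :: v) 0 ->
      (forall m, m < n -> exists k, peval f (m :: v) k.+1) ->
      peval (PMu f) v n
with pevals : list prf -> seq nat -> seq nat -> Prop :=
  | evs_nil v : pevals nil v [::]
  | evs_cons g gs v y ys :
      peval g v y -> pevals gs v ys -> pevals (cons g gs) v (y :: ys).

Definition ce (A : nat -> Prop) : Prop :=
  exists p : prf, forall n, A n <-> exists y, peval p [:: n] y.

Fixpoint code_str (s : seq bool) : nat :=
  match s with
  | [::] => 1
  | b :: s' => (code_str s').*2 + b
  end.
Definition cpair (i n : nat) : nat := ((i + n) * (i + n).+1)./2 + n.

Definition cantor := nat -> bool.
Definition cset := cantor -> Prop.

Definition cyl (s : seq bool) : cset :=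
  fun X => forall k, k < size s -> X k = nth false s k.

Definition csubset (A B : cset) : Prop := forall X, A X -> B X.

Definition copen (U : cset) : Prop :=
  forall X, U X -> exists s, cyl s X /\ csubset (cyl s) U.

Fixpoint allstr (n : nat) : seq (seq bool) :=
  match n with
  | 0 => [:: [::]]
  | n'.+1 => [seq b :: s | b <- [:: false; true], s <- allstr n']
  end.

(* Lebesgue measure of the finite union of cylinders [sigma], sigma in F *)
Definition lam_fin (F : seq (seq bool)) : rat :=
  let n := \max_(s <- F) size s in
  ((count (fun t => has (fun s => prefix s t) F) (allstr n))%:R / (2 ^ n)%:R)%R.

(* lambda(U) <= r for an open U: lambda(U) is the supremum of the measures of
   the finite unions of basic cylinders contained in U. *)
Definition lam_le (U : cset) (r : rat) : Prop :=
  forall F : seq (seq bool),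
    (forall s, s \in F -> csubset (cyl s) U) -> (lam_fin F <= r)%R.

Definition unif_eff_open (U : nat -> cset) : Prop :=
  (forall i, copen (U i)) /\
  ce (fun n => exists i s, n = cpair i (code_str s) /\ csubset (cyl s) (U i)).

Definition ML_test (V : nat -> cset) : Prop :=
  unif_eff_open V /\ forall i, lam_le (V i) (((2 ^ i)%:R)^-1)%R.

Definition universal_ML (U : nat -> cset) : Prop :=
  ML_test U /\
  forall V, ML_test V ->
    forall X, (forall i, V i X) -> (forall i, U i X).

(* Main.v *)
Require Import Defs.
From mathcomp Require Import all_boot all_order all_algebra.
From mathcomp Require Import zify.
From Stdlib Require Import ClassicalEpsilon.
Set Implicit Arguments. Unset Strict Implicit. Unset Printing Implicit Defensive.

(** Let the j-th block consist of the positions 2^(j+1), ..., 2^(j+2) - 1, and let V_j be the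
    clopen set of the sequences whose first all-zero block is the j-th one.  The V_j are pairwise
    disjoint, so a sequence lies in at most one of them.  The universal test U_i collects,
    for every index e, the component n = e + i + 3 + 2^(e+1) of the e-th (truncated)
    Martin-Loef test, but only through strings whose first all-zero block is not known to
    be some j > e.  As every test has arbitrarily large indices, each sequence in its
    intersection is captured.  On the other hand, conditioned on V_j the contribution of e
    is small: for e >= j because n is large compared with the measure of V_j, and for
    e < j because only strings ending before the j-th block contribute, and these are
    independent of it.  So the conditional measure of U_0 in V_j is below 1. *)

(** * Computable functions of fixed arity *)

Definition cfun n (f : seq nat -> nat) :=
  exists p, forall v, size v = n -> peval p v (f v).

Lemma cfun_ext n f g : (forall v, size v = n -> f v = g v) -> cfun n f -> cfun n g.
Proof. by move=> e [p Hp]; exists p => v Hv; rewrite -e //; apply: Hp. Qed.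

Lemma cfun_nth n i : cfun n (fun v => nth 0 v i).
Proof. by exists (PProj i) => v _; constructor. Qed.

Lemma cfun_comp n f gs : cfun (size gs) f -> (forall g, List.In g gs -> cfun n g) ->
  cfun n (fun v => f [seq g v | g <- gs]).
Proof.
case=> p Hp H.
have [ps Hps] : exists ps, forall v, size v = n -> pevals ps v [seq g v | g <- gs].
  elim: gs {p Hp} H => [|g gs IH] H; first by exists nil => v _; constructor.
  have [q Hq] := H g (or_introl erefl).
  have [|qs Hqs] := IH; first by move=> h Hh; apply: H; right.
  by exists (q :: qs) => v Hv; constructor; [apply: Hq|apply: Hqs].
exists (PComp p ps) => v Hv; econstructor; first exact: Hps.
by apply: Hp; rewrite size_map.
Qed.

Lemma cfun_app1 n f g : cfun 1 (fun v => f (nth 0 v 0)) -> cfun n g ->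
  cfun n (fun v => f (g v)).
Proof. by move=> Hf H; apply: (cfun_comp (gs := [:: g]) Hf) => h /= [<-|[]]. Qed.

Lemma cfun_app2 n f g1 g2 : cfun 2 (fun v => f (nth 0 v 0) (nth 0 v 1)) ->
  cfun n g1 -> cfun n g2 -> cfun n (fun v => f (g1 v) (g2 v)).
Proof.
by move=> Hf H1 H2; apply: (cfun_comp (gs := [:: g1; g2]) Hf) => h /= [<-|[<-|[]]].
Qed.

Lemma cfun_app3 n f g1 g2 g3 :
  cfun 3 (fun v => f (nth 0 v 0) (nth 0 v 1) (nth 0 v 2)) ->
  cfun n g1 -> cfun n g2 -> cfun n g3 -> cfun n (fun v => f (g1 v) (g2 v) (g3 v)).
Proof.
move=> Hf H1 H2 H3; apply: (cfun_comp (gs := [:: g1; g2; g3]) Hf).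
by move=> h /= [<-|[<-|[<-|[]]]].
Qed.

Lemma cfun_succ n f : cfun n f -> cfun n (fun v => (f v).+1).
Proof. by apply: (cfun_app1 (f := S)); exists PSucc => v _; constructor. Qed.

Lemma cfun_const n k : cfun n (fun=> k).
Proof.
elim: k => [|k IH]; first by exists PZero => v _; constructor.
exact: (cfun_succ IH).
Qed.

(** Inside a bounded quantifier or sum the bound variable is the head of the list, and the outer
    variables are read through [behead]. *)
Lemma cfun_shift n (g : seq nat -> seq nat) i :
  cfun n (fun v => nth 0 (g v) i.+1) -> cfun n (fun v => nth 0 (behead (g v)) i).
Proof. by move=> H; apply: cfun_ext H => v _; rewrite nth_behead. Qed.

Lemma map_nth_mkseq n (v : seq nat) : size v = n ->
  [seq g v | g <- mkseq (fun i v => nth 0 v i) n] = v.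
Proof. by move=> <-; rewrite -map_comp /comp /=; apply: mkseq_nth. Qed.

Lemma In_map (S T : Type) (F : S -> T) s g : List.In g [seq F i | i <- s] -> exists i, g = F i.
Proof. by elim: s => //= i s IH [<-|/IH //]; exists i. Qed.

(** [F] is given by its recursion equations, so that library functions and sums fit without being
    redefined. The parameters are the whole list [v], placed behind the counter. *)
Lemma cfun_prec n (f : seq nat -> nat) (h : nat -> nat -> seq nat -> nat) g F :
  cfun n f -> cfun n.+2 (fun v => h (nth 0 v 0) (nth 0 v 1) (behead (behead v))) ->
  cfun n g ->
  (forall v, F 0 v = f v) -> (forall k v, F k.+1 v = h k (F k v) v) ->
  cfun n (fun v => F (g v) v).
Proof.
case=> p Hp [q Hq] Hg F0 FS.
have HF : cfun n.+1 (fun v => F (nth 0 v 0) (behead v)).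
  exists (PPrec p q) => -[//|k v] [Hv] /=.
  elim: k => [|k IH]; first by rewrite F0; constructor; apply: Hp.
  rewrite FS; econstructor; first exact: IH.
  by apply: (Hq [:: k, F k v & v]); rewrite /= Hv.
pose gs := g :: mkseq (fun i v => nth 0 v i) n.
have Hgs : cfun (size gs) (fun v => F (nth 0 v 0) (behead v)) by rewrite /= size_mkseq.
apply: (cfun_ext _ (cfun_comp Hgs _)) => [v Hv|h'] /=.
  by rewrite map_nth_mkseq.
by case=> [<- //|H]; have [i ->] := In_map H; apply: cfun_nth.
Qed.

Lemma cfun_add n f g : cfun n f -> cfun n g -> cfun n (fun v => f v + g v).
Proof.
apply: cfun_app2.
apply: (@cfun_prec _ (fun v => nth 0 v 1) (fun _ z _ => z.+1) (fun v => nth 0 v 0)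
  (fun k v => k + nth 0 v 1)) => //; try exact: cfun_nth.
by apply: cfun_succ; apply: cfun_nth.
Qed.

Lemma cfun_pred n f : cfun n f -> cfun n (fun v => (f v).-1).
Proof.
apply: (cfun_app1 (f := predn)).
apply: (@cfun_prec _ (fun=> 0) (fun k _ _ => k) (fun v => nth 0 v 0)
  (fun k v => k.-1)) => //; try exact: cfun_nth.
exact: cfun_const.
Qed.

Lemma cfun_sub n f g : cfun n f -> cfun n g -> cfun n (fun v => f v - g v).
Proof.
apply: cfun_app2.
apply: (@cfun_prec _ (fun v => nth 0 v 0) (fun _ z _ => z.-1) (fun v => nth 0 v 1)
  (fun k v => nth 0 v 0 - k)) => //; try exact: cfun_nth.
- by apply: cfun_pred; apply: cfun_nth.
- by move=> v; rewrite subn0.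
- by move=> k v; rewrite subnS.
Qed.

Lemma cfun_mul n f g : cfun n f -> cfun n g -> cfun n (fun v => f v * g v).
Proof.
apply: cfun_app2.
apply: (@cfun_prec _ (fun=> 0) (fun _ z v => nth 0 v 1 + z) (fun v => nth 0 v 0)
  (fun k v => k * nth 0 v 1)) => //; try exact: cfun_nth; first exact: cfun_const.
by apply: cfun_add; [do 2!apply: cfun_shift; apply: cfun_nth|apply: cfun_nth].
Qed.

Lemma cfun_exp n f g : cfun n f -> cfun n g -> cfun n (fun v => f v ^ g v).
Proof.
apply: cfun_app2.
apply: (@cfun_prec _ (fun=> 1) (fun _ z v => nth 0 v 0 * z) (fun v => nth 0 v 1)
  (fun k v => nth 0 v 0 ^ k)) => //; try exact: cfun_nth; first exact: cfun_const.
  by apply: cfun_mul; [do 2!apply: cfun_shift; apply: cfun_nth|apply: cfun_nth].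
by move=> k v; rewrite expnS.
Qed.

Lemma cfun_sum n (F : nat -> seq nat -> nat) g :
  cfun n.+1 (fun v => F (nth 0 v 0) (behead v)) -> cfun n g ->
  cfun n (fun v => \sum_(k < g v) F k v).
Proof.
move=> [p Hp] Hg.
apply: (@cfun_prec _ (fun=> 0) (fun k z v => z + F k v) g
  (fun k v => \sum_(i < k) F i v)) => //; first exact: cfun_const.
- apply: cfun_add; first exact: cfun_nth.
  (* The summand must not see the accumulator, so the projections skip position 1. *)
  pose gs := (fun v => nth 0 v 0) :: mkseq (fun i v => nth 0 v i.+2) n.
  have Hgs : cfun (size gs) (fun v => F (nth 0 v 0) (behead v)).
    by rewrite /= size_mkseq; exists p.
  apply: (cfun_ext _ (cfun_comp Hgs _)) => [v Hv|h'] /=; last first.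
    by case=> [<-|H]; [|have [i ->] := In_map H]; apply: cfun_nth.
  congr F; rewrite -map_comp /comp -[RHS](mkseq_nth 0) 2!size_behead Hv /=.
  by apply: eq_map => i; rewrite !nth_behead.
- by move=> v; rewrite big_ord0.
- by move=> k v; rewrite big_ord_recr.
Qed.

Lemma cfun_leq n f g : cfun n f -> cfun n g -> cfun n (fun v => nat_of_bool (f v <= g v)).
Proof.
move=> Hf Hg; apply: cfun_ext (cfun_sub (cfun_const n 1) (cfun_sub Hf Hg)) => v _.
by rewrite -subn_eq0; case: (f v - g v).
Qed.

Lemma cfun_neg n (P : seq nat -> bool) : cfun n (fun v => nat_of_bool (P v)) ->
  cfun n (fun v => nat_of_bool (~~ P v)).
Proof.
by move=> H; apply: cfun_ext (cfun_sub (cfun_const n 1) H) => v _; case: (P v).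
Qed.

Lemma cfun_and n (P Q : seq nat -> bool) : cfun n (fun v => nat_of_bool (P v)) ->
  cfun n (fun v => nat_of_bool (Q v)) -> cfun n (fun v => nat_of_bool (P v && Q v)).
Proof. by move=> H K; apply: cfun_ext (cfun_mul H K) => v _; rewrite mulnb. Qed.

Lemma cfun_or n (P Q : seq nat -> bool) : cfun n (fun v => nat_of_bool (P v)) ->
  cfun n (fun v => nat_of_bool (Q v)) -> cfun n (fun v => nat_of_bool (P v || Q v)).
Proof.
move=> H K; apply: cfun_ext (cfun_neg (cfun_and (cfun_neg H) (cfun_neg K))) => v _.
by rewrite negb_and !negbK.
Qed.

Lemma cfun_imp n (P Q : seq nat -> bool) : cfun n (fun v => nat_of_bool (P v)) ->
  cfun n (fun v => nat_of_bool (Q v)) -> cfun n (fun v => nat_of_bool (P v ==> Q v)).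
Proof. by move=> H K; apply: cfun_ext (cfun_or (cfun_neg H) K) => v _; rewrite implybE. Qed.

Lemma cfun_eq n f g : cfun n f -> cfun n g -> cfun n (fun v => nat_of_bool (f v == g v)).
Proof.
move=> Hf Hg; apply: cfun_ext (cfun_and (cfun_leq Hf Hg) (cfun_leq Hg Hf)) => v _.
by rewrite eqn_leq.
Qed.

Definition bex n (P : pred nat) := has P (iota 0 n).
Definition ball n (P : pred nat) := all P (iota 0 n).

Lemma bexP n (P : pred nat) : reflect (exists2 k, k < n & P k) (bex n P).
Proof. by apply: (iffP hasP) => -[k]; rewrite ?mem_iota => A B; exists k; rewrite ?mem_iota. Qed.

Lemma ballP n (P : pred nat) : reflect (forall k, k < n -> P k) (ball n P).
Proof. by apply: (iffP allP) => H k Hk; apply: H; rewrite mem_iota in Hk *. Qed.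

Lemma cfun_bex n (P : nat -> seq nat -> bool) g :
  cfun n.+1 (fun v => nat_of_bool (P (nth 0 v 0) (behead v))) -> cfun n g ->
  cfun n (fun v => nat_of_bool (bex (g v) (fun k => P k v))).
Proof.
move=> H K.
apply: cfun_ext (cfun_leq (cfun_const n 1) (cfun_sum (F := fun k v => P k v : nat) H K)) => v _.
congr nat_of_bool; rewrite lt0n sum_nat_eq0 negb_forall; apply/existsP/bexP.
  by case=> k /=; rewrite eqb0 negbK; exists k.
by case=> k Hk Pk; exists (Ordinal Hk); rewrite /= eqb0 Pk.
Qed.

Lemma cfun_ball n (P : nat -> seq nat -> bool) g :
  cfun n.+1 (fun v => nat_of_bool (P (nth 0 v 0) (behead v))) -> cfun n g ->
  cfun n (fun v => nat_of_bool (ball (g v) (fun k => P k v))).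
Proof.
move=> H K.
apply: cfun_ext (cfun_neg (cfun_bex (P := fun k v => ~~ P k v) (cfun_neg H) K)) => v _.
congr nat_of_bool; rewrite /bex /ball has_predC negbK; exact: eq_all.
Qed.

(** Numbers below [2 ^ T] stand for the strings of length [T], so [cnt T P] divided by [2 ^ T] is
    the measure of a clopen set. *)
Definition cnt T (P : pred nat) := \sum_(x < 2 ^ T) P x.

Lemma cfun_cnt n (P : nat -> seq nat -> bool) g :
  cfun n.+1 (fun v => nat_of_bool (P (nth 0 v 0) (behead v))) -> cfun n g ->
  cfun n (fun v => cnt (g v) (fun k => P k v)).
Proof.
by move=> H K; apply: (cfun_sum (F := fun k v => P k v : nat)) => //; apply: cfun_exp => //;
  apply: cfun_const.
Qed.

Lemma cfun_div n f g : cfun n f -> cfun n g -> cfun n (fun v => f v %/ g v).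
Proof.
apply: cfun_app2.
(* For [d > 0] the quotient of [x] by [d] is the number of [k < x] with [(k + 1) * d <= x]; the
   first factor yields the value 0 for division by 0. *)
have H : cfun 2 (fun v => (0 < nth 0 v 1) *
   \sum_(k < nth 0 v 0) (k.+1 * nth 0 v 1 <= nth 0 v 0)).
  apply: cfun_mul; first by apply: cfun_leq; [apply: cfun_const|apply: cfun_nth].
  apply: (cfun_sum (F := fun k v => (k.+1 * nth 0 v 1 <= nth 0 v 0) : nat)); last exact: cfun_nth.
  apply: cfun_leq; last by apply: cfun_shift; apply: cfun_nth.
  by apply: cfun_mul; [apply: cfun_succ; apply: cfun_nth|apply: cfun_shift; apply: cfun_nth].
apply: cfun_ext H => v _; set x := nth 0 v 0; set d := nth 0 v 1.
case: (posnP d) => [->|d0]; first by rewrite divn0.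
rewrite mul1n; under eq_bigr => k _ do rewrite -leq_divRL //.
have : x %/ d <= x by apply: leq_div.
move: (x %/ d) => q; elim: x => [|x IH]; first by rewrite big_ord0; case: q.
rewrite leq_eqVlt => /orP [/eqP ->|]; last first.
  by rewrite ltnS => Hq; rewrite big_ord_recr /= IH // ltnNge Hq addn0.
rewrite (eq_bigr (fun=> 1)) ?sum1_card ?card_ord // => i _; by rewrite ltn_ord.
Qed.

Lemma cfun_mod n f g : cfun n f -> cfun n g -> cfun n (fun v => f v %% g v).
Proof.
move=> Hf Hg; apply: cfun_ext (cfun_sub Hf (cfun_mul (cfun_div Hf Hg) Hg)) => v _.
by rewrite /= [X in X - _](divn_eq (f v) (g v)) addKn.
Qed.

Lemma cfun_odd n f : cfun n f -> cfun n (fun v => nat_of_bool (odd (f v))).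
Proof.
move=> Hf; apply: cfun_ext (cfun_mod Hf (cfun_const n 2)) => v _; exact: modn2.
Qed.

Lemma cfun_cpair n f g : cfun n f -> cfun n g -> cfun n (fun v => cpair (f v) (g v)).
Proof.
move=> Hf Hg; have Hs := cfun_add Hf Hg.
apply: cfun_ext (cfun_add (cfun_div (cfun_mul Hs (cfun_succ Hs)) (cfun_const n 2)) Hg).
by move=> v _; rewrite /cpair divn2.
Qed.


(** * Determinism of evaluation, and enumerability by unbounded search *)

Lemma prf_nested_ind (P : prf -> Prop) :
  P PZero -> P PSucc -> (forall i, P (PProj i)) ->
  (forall f gs, P f -> (forall g, List.In g gs -> P g) -> P (PComp f gs)) ->
  (forall f g, P f -> P g -> P (PPrec f g)) -> (forall f, P f -> P (PMu f)) ->
  forall p, P p.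
Proof.
move=> H0 H1 H2 H3 H4 H5; fix IH 1 => -[| |i|f gs|f g|f].
- exact: H0.
- exact: H1.
- exact: H2.
- apply: H3; first exact: IH.
  by elim: gs => [|g gs IHgs] h []; [move=> <-; exact: IH|exact: IHgs].
- exact: (H4 f g (IH f) (IH g)).
- exact: (H5 f (IH f)).
Qed.

Lemma peval_det p : forall v y z, peval p v y -> peval p v z -> y = z.
Proof.
elim/prf_nested_ind: p => [| |i|f gs IHf IHgs|f g IHf IHg|f IHf] v y z Hy Hz.
- by inversion Hy; inversion Hz.
- by inversion Hy; inversion Hz.
- by inversion Hy; inversion Hz.
- inversion Hy as [| | |? ? ? ys ? Hys Hfy| | |].
  inversion Hz as [| | |? ? ? zs ? Hzs Hfz| | |]; subst.
  suff E : ys = zs by rewrite E in Hfy; apply: IHf Hfy Hfz.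
  move: IHgs ys zs Hys Hzs {Hy Hz Hfy Hfz}; elim: gs => [|g gs IH] IHgs ys zs Hys Hzs.
    by inversion Hys; inversion Hzs.
  inversion Hys as [|? ? ? a ys' Ha Hys']; inversion Hzs as [|? ? ? b zs' Hb Hzs']; subst.
  congr cons; first by apply: (IHgs g _ _ _ _ Ha Hb); left.
  by apply: IH Hys' Hzs' => h Hh; apply: IHgs; right.
- case: v Hy Hz => [|n v] Hy Hz; first by inversion Hy.
  elim: n y z Hy Hz => [|n IHn] y z Hy Hz.
    by inversion Hy; inversion Hz; subst; apply: (IHf v).
  inversion Hy as [| | | | |? ? ? ? a ? Ha Hga|].
  inversion Hz as [| | | | |? ? ? ? b ? Hb Hgb|]; subst.
  by move: (IHn _ _ Ha Hb) => E; subst; apply: (IHg _ _ _ Hga Hgb).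
- inversion Hy as [| | | | | |? ? ? Hy0 Hym]; inversion Hz as [| | | | | |? ? ? Hz0 Hzm]; subst.
  case: (ltngtP y z) => // [/Hzm [k Hk]|/Hym [k Hk]].
    by have := IHf _ _ _ Hy0 Hk.
  by have := IHf _ _ _ Hz0 Hk.
Qed.

(** [PMu] looks for a zero, hence the negated [P] with the witness as first argument. Since [P] is
    total, the search halts at the least witness; by determinism a halting search has found a
    witness. *)
Lemma ce_cfun (A : nat -> Prop) (P : nat -> nat -> bool) :
  cfun 2 (fun v => nat_of_bool (P (nth 0 v 0) (nth 0 v 1))) ->
  (forall n, A n <-> exists w, P n w) -> ce A.
Proof.
move=> HP HA.
have [q Hq] : cfun 2 (fun v => nat_of_bool (~~ P (nth 0 v 1) (nth 0 v 0))).
  apply: cfun_neg; apply: (cfun_app2 (f := fun a b => P a b : nat)) => //; exact: cfun_nth.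
have evq w n : peval q [:: w; n] (~~ P n w) by apply: (Hq [:: w; n]).
exists (PMu q) => n; rewrite HA; split.
  move=> Hw; exists (ex_minn Hw); case: ex_minnP => w Pw wmin.
  constructor; first by have := evq w n; rewrite Pw.
  move=> m Hm; exists 0; have := evq m n.
  by case: (boolP (P n m)) => // /wmin; rewrite leqNgt Hm.
case=> w H; inversion H as [| | | | | | ? ? ? H0 _]; subst; exists w.
by have := peval_det (evq w n) H0; case: (P n w).
Qed.

Ltac cfun_tac :=
  lazymatch goal with
  | |- cfun _ (fun=> ?c) => exact: cfun_const
  | |- cfun _ (fun v => nat_of_bool (@?f v && @?g v)) => apply: cfun_and; cfun_tac
  | |- cfun _ (fun v => nat_of_bool (@?f v || @?g v)) => apply: cfun_or; cfun_tac
  | |- cfun _ (fun v => nat_of_bool (@?f v ==> @?g v)) => apply: cfun_imp; cfun_tac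
  | |- cfun _ (fun v => nat_of_bool (~~ @?f v)) => apply: cfun_neg; cfun_tac
  | |- cfun _ (fun v => nat_of_bool (@?f v <= @?g v)) => apply: cfun_leq; cfun_tac
  | |- cfun _ (fun v => nat_of_bool (@?f v == @?g v)) => apply: cfun_eq; cfun_tac
  | |- cfun _ (fun v => nat_of_bool (odd (@?f v))) => apply: cfun_odd; cfun_tac
  | |- cfun _ (fun v => nat_of_bool (bex (@?g v) _)) => apply: cfun_bex; cfun_tac
  | |- cfun _ (fun v => nat_of_bool (ball (@?g v) _)) => apply: cfun_ball; cfun_tac
  | |- cfun _ (fun v => S (@?f v)) => apply: cfun_succ; cfun_tac
  | |- cfun _ (fun v => @?f v + @?g v) => apply: cfun_add; cfun_tac
  | |- cfun _ (fun v => @?f v - @?g v) => apply: cfun_sub; cfun_tac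
  | |- cfun _ (fun v => @?f v * @?g v) => apply: cfun_mul; cfun_tac
  | |- cfun _ (fun v => @?f v ^ @?g v) => apply: cfun_exp; cfun_tac
  | |- cfun _ (fun v => @?f v %/ @?g v) => apply: cfun_div; cfun_tac
  | |- cfun _ (fun v => @?f v %% @?g v) => apply: cfun_mod; cfun_tac
  | |- cfun _ (fun v => cpair (@?f v) (@?g v)) => apply: cfun_cpair; cfun_tac
  | |- cfun _ (fun v => nth 0 (behead (@?g v)) _) => apply: cfun_shift; cfun_tac
  | |- cfun _ (fun v => nth 0 v _) => exact: cfun_nth
  | |- cfun _ (fun v => cnt (@?g v) _) => apply: cfun_cnt; cfun_tac
  | |- _ => idtac
  end.

(** * A universal computable enumeration predicate *)

(* Programs, argument lists and judgements are coded as lists, with [0] as [nil] and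
   [cc] as [cons]; [jud 0 p v y] codes [peval p v y], [jud 1 gs v ys] codes
   [pevals gs v ys], and [jud 2 v i x] codes [nth 0 v i = x]. *)
Definition cc a l := (cpair a l).+1.
Definition jud k a b c := cc k (cc a (cc b (cc c 0))).

Definition bex6 B (P : nat -> nat -> nat -> nat -> nat -> nat -> bool) :=
  bex B (fun a => bex B (fun b => bex B (fun c => bex B (fun d => bex B (fun e =>
  bex B (fun f => P a b c d e f)))))).

Definition rules B (M : pred nat) x a b c d e f :=
  [|| x == jud 2 0 a 0,
      x == jud 2 (cc a b) 0 a,
      (x == jud 2 (cc a b) c.+1 d) && M (jud 2 b c d),
      x == jud 1 0 a 0,
      [&& x == jud 1 (cc a b) c (cc d e), M (jud 0 a c d) & M (jud 1 b c e)],
      x == jud 0 (cc 0 0) a 0,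
      (x == jud 0 (cc 1 0) a b.+1) && M (jud 2 a 0 b),
      (x == jud 0 (cc 2 (cc a 0)) b c) && M (jud 2 b a c),
      [&& x == jud 0 (cc 3 (cc a (cc b 0))) c d, M (jud 1 b c e) & M (jud 0 a e d)],
      (x == jud 0 (cc 4 (cc a (cc b 0))) (cc 0 c) d) && M (jud 0 a c d),
      [&& x == jud 0 (cc 4 (cc a (cc b 0))) (cc c.+1 d) e,
          M (jud 0 (cc 4 (cc a (cc b 0))) (cc c d) f)
        & M (jud 0 b (cc c (cc f d)) e)]
    | [&& x == jud 0 (cc 5 (cc a 0)) b c, M (jud 0 a (cc c b) 0)
        & ball c (fun m => bex B (fun k => M (jud 0 a (cc m b) k.+1)))]].

Definition just B M x := bex6 B (rules B M x).

(* [W] codes a finite set of judgements by its binary digits.  [cert] asks each of them to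
   follow from others by a rule; circular justifications are impossible, because the
   premises concern smaller programs, or the same recursion at a smaller argument. *)
Definition mem_code B W x := (x < B) && odd (W %/ 2 ^ x).
Definition cert B W := ball B (fun x => mem_code B W x ==> just B (mem_code B W) x).

Definition univ e n w :=
  bex w (fun B => bex w (fun W => bex w (fun y =>
    cert B W && mem_code B W (jud 0 e (cc n 0) y)))).

Lemma cfun_univ : cfun 3 (fun v => nat_of_bool (univ (nth 0 v 0) (nth 0 v 1) (nth 0 v 2))).
Proof.
rewrite /univ /cert /just /bex6 /rules /mem_code /jud /cc; cfun_tac.
Qed.

(** * Binary codes of prefixes and of lists *)

Definition lvl (X : nat -> bool) t := \sum_(k < t) X k * 2 ^ k.

Lemma lvlS X t : lvl X t.+1 = lvl X t + X t * 2 ^ t.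
Proof. exact: big_ord_recr. Qed.

Lemma lvl_lt X t : lvl X t < 2 ^ t.
Proof.
elim: t => [|t IH]; first by rewrite /lvl big_ord0.
by rewrite lvlS expnS; case: (X t); lia.
Qed.

Lemma lvlD X l k : lvl X (l + k) = lvl X l + 2 ^ l * lvl (fun i => X (l + i)) k.
Proof.
elim: k => [|k IH]; first by rewrite /lvl big_ord0 muln0 !addn0.
by rewrite addnS !lvlS IH mulnDr addnA expnD; congr addn; rewrite mulnCA.
Qed.

(** The first bit is the least significant digit, so shortening a prefix to length [l] is taking the
    remainder modulo [2 ^ l]. Later sections truncate strings in this way. *)
Lemma lvl_mod X l t : l <= t -> lvl X t %% 2 ^ l = lvl X l.
Proof.
move=> /subnKC <-; rewrite lvlD mulnC addnC modnMDl modn_small //; exact: lvl_lt.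
Qed.

Lemma lvl_bit X t k : k < t -> odd (lvl X t %/ 2 ^ k) = X k.
Proof.
move=> kt; rewrite (_ : t = k + (1 + (t - k.+1))); last by lia.
rewrite lvlD mulnC addnC divnMDl ?expn_gt0 // divn_small ?lvl_lt // addn0 lvlD.
rewrite /lvl big_ord1 /= !addn0 muln1.
by case: (X k); rewrite oddD oddM.
Qed.

Definition bits x k := odd (x %/ 2 ^ k).

Lemma lvl_bits x t : lvl (bits x) t = x %% 2 ^ t.
Proof.
elim: t => [|t IH]; first by rewrite /lvl big_ord0 modn1.
rewrite lvlS IH /bits.
have := divn_eq x (2 ^ t); have := divn_eq (x %/ 2 ^ t) 2.
rewrite modn2; set q := _ %/ 2; set r := x %% 2 ^ t; set b := nat_of_bool _ => E1 E2.
rewrite [in RHS]E2 E1 mulnDl -mulnA -expnS -addnA modnMDl modn_small 1?addnC //.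
have : r < 2 ^ t by rewrite ltn_mod expn_gt0.
by rewrite /b expnS; case: odd; lia.
Qed.

Lemma eq_lvl X Y t : (forall k, k < t -> X k = Y k) -> lvl X t = lvl Y t.
Proof. by move=> H; apply: eq_bigr => k _; rewrite H. Qed.

Lemma lvl_eq X Y t : lvl X t = lvl Y t -> forall k, k < t -> X k = Y k.
Proof. by move=> E k kt; rewrite -(lvl_bit X kt) E lvl_bit. Qed.

(** With [T] the triangular numbers, [cpair i n] lies between [T (i + n)] and [T (i + n).+1], the
    latter excluded. It thus determines [i + n], and then [n] as the offset. *)
Lemma cpair_inj i n i' n' : cpair i n = cpair i' n' -> i = i' /\ n = n'.
Proof.
pose T s := (s * s.+1)./2.
have TS s : T s.+1 = T s + s.+1.
  rewrite /T (_ : s.+1 * s.+2 = s.+1.*2 + s * s.+1); last by lia.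
  by rewrite halfD odd_double doubleK add0n addnC.
have Tmono s s' : s < s' -> T s.+1 <= T s'.
  by elim: s' => // s' IH; rewrite ltnS leq_eqVlt => /orP [/eqP ->|/IH]; rewrite ?TS //; lia.
rewrite /cpair -/(T (i + n)) -/(T (i' + n')) => E.
have Ts := TS (i + n); have Ts' := TS (i' + n').
case: (ltngtP (i + n) (i' + n')) => [/Tmono|/Tmono|e]; try by lia.
by rewrite e in E; lia.
Qed.

Lemma ccE a l b m : (cc a l == cc b m) = (a == b) && (l == m).
Proof.
apply/eqP/andP => [[/cpair_inj [-> ->]]|[/eqP -> /eqP ->]] //.
Qed.
Lemma cc0E a l : (cc a l == 0) = false. Proof. by []. Qed.
Lemma E0cc a l : (0 == cc a l) = false. Proof. by []. Qed.
Definition ccEs := (ccE, cc0E, E0cc).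

Lemma leq_cpair a b : (a <= cpair a b) && (b <= cpair a b).
Proof.
rewrite /cpair leq_addl andbT.
have : (a + b) <= ((a + b) * (a + b).+1)./2.
  by rewrite -[X in X <= _]doubleK half_leq //; case: (a + b) => // s; nia.
lia.
Qed.

Lemma bex6P B (P : nat -> nat -> nat -> nat -> nat -> nat -> bool) : bex6 B P ->
  exists a b c d e f, P a b c d e f.
Proof.
move=> /bexP [a _ /bexP [b _ /bexP [c _ /bexP [d _ /bexP [e _ /bexP [f _ H]]]]]].
by exists a, b, c, d, e, f.
Qed.

Lemma bex6I B (P : nat -> nat -> nat -> nat -> nat -> nat -> bool) a b c d e f :
  [&& a < B, b < B, c < B, d < B, e < B & f < B] ->
  P a b c d e f -> bex6 B P.
Proof.
move=> /and5P [Ha Hb Hc Hd /andP [He Hf]] H.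
by apply/bexP; exists a => //; apply/bexP; exists b => //; apply/bexP; exists c => //;
  apply/bexP; exists d => //; apply/bexP; exists e => //; apply/bexP; exists f.
Qed.

Lemma ltn_cc a b : (a < cc a b) && (b < cc a b).
Proof. by rewrite /cc !ltnS leq_cpair. Qed.

Opaque cc.

Fixpoint cs v := if v is a :: l then cc a (cs l) else 0.

Fixpoint cprf p := match p with
  | PZero => cs [:: 0]
  | PSucc => cs [:: 1]
  | PProj i => cs [:: 2; i]
  | PComp f gs => cs [:: 3; cprf f; cs (map cprf gs)]
  | PPrec f g => cs [:: 4; cprf f; cprf g]
  | PMu f => cs [:: 5; cprf f]
  end.

(** * Soundness of certificates *)

Section Soundness.
Variables (B : nat) (M : pred nat).
Hypothesis M_just : forall x, M x -> just B M x.

Ltac destr :=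
  repeat match goal with
  | |- is_true (_ || _) -> _ => case/orP
  | |- is_true (_ && _) -> _ => case/andP
  | |- is_true (_ == _) -> _ => move/eqP => ?
  | |- is_true (M _) -> _ => move=> ?
  | |- is_true (ball _ _) -> _ => move/ballP => ?
  | |- is_true false -> _ => by []
  end.

(** Comparing codes with [ccEs] discards every rule whose conclusion does not match the
    judgement. *)
Ltac inv H := have := M_just H => /bex6P [? [? [? [? [? [?]]]]]];
  rewrite /rules /jud !ccEs ?eqSS /=; destr; subst.

Lemma sound_nth v i x : M (jud 2 (cs v) i x) -> x = nth 0 v i.
Proof.
elim: v i x => [|h v IH] i x H; inv H => //; first by rewrite nth_nil.
exact: IH.
Qed.

(** Soundness for the members of [gs] is a hypothesis because the lemma is applied inside the
    induction on programs. *)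
Lemma sound_evals gs v :
  (forall g, List.In g gs -> forall y, M (jud 0 (cprf g) (cs v) y) -> peval g v y) ->
  forall z, M (jud 1 (cs (map cprf gs)) (cs v) z) ->
  exists2 ys, z = cs ys & pevals gs v ys.
Proof.
elim: gs => [|g gs IH] Hg z /= H; inv H.
  by exists [::] => //; constructor.
have [|ys -> Hys] := IH _ _ ltac:(eassumption); first by move=> h Hh; apply: Hg; right.
eexists (_ :: ys) => //; constructor=> //; apply: Hg => //; by left.
Qed.

Lemma sound_eval p v y : M (jud 0 (cprf p) (cs v) y) -> peval p v y.
Proof.
elim/prf_nested_ind: p v y => [| |i|f gs IHf IHgs|f g IHf IHg|f IHf] v y H.
- by inv H; constructor.
- by inv H; match goal with K : is_true (M (cc 2 _)) |- _ => rewrite (sound_nth K) end; constructor.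
- by inv H; match goal with K : is_true (M (cc 2 _)) |- _ => rewrite (sound_nth K) end; constructor.
- inv H.
  have [ys E Hys] := sound_evals (fun g Hg y => IHgs g Hg v y) ltac:(eassumption).
  by subst; econstructor; [apply: Hys|apply: IHf].
- case: v H => [|k v] H; first by inv H.
  (* The recursive premise concerns the same program at a smaller counter, which calls for an inner
     induction on the counter. *)
  elim: k y H => [|k IHk] y H; inv H; first by constructor; apply: IHf.
  econstructor; first by apply: IHk; eassumption.
  exact: IHg.
- inv H; constructor; first exact: IHf.
  move=> m Hm.
  match goal with K : forall k, _ -> is_true (bex _ _) |- _ =>
    have /bexP [k _ Hk] := K m Hm end.
  by exists k; apply: IHf.
Qed.

End Soundness.

(** * Completeness of certificates *)

Lemma rules_mono B B' (M M' : pred nat) x a b c d e f :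
  B <= B' -> (forall z, M z -> M' z) ->
  rules B M x a b c d e f -> rules B' M' x a b c d e f.
Proof.
move=> BB MM.
have HA (P Q Q' : bool) : (Q -> Q') -> P && Q -> P && Q' by case: P.
have HA3 (P Q Q' R R' : bool) : (Q -> Q') -> (R -> R') -> [&& P, Q & R] -> [&& P, Q' & R'].
  by case: P; case: Q => // q r /= h; rewrite q // r.
have HO (P Q P' Q' : bool) : (P -> P') -> (Q -> Q') -> P || Q -> P' || Q'.
  by case: P => /= h k; [move=> _; rewrite h|move=> /k ->; rewrite orbT].
rewrite /rules; do 11 (apply: (HO); first by [|apply: (HA); apply: (MM)|apply: (HA3); apply: (MM)]).
apply: HA3; first exact: MM.
move=> /ballP H; apply/ballP => m /H /bexP [k Hk /MM Mk].
by apply/bexP; exists k => //; lia.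
Qed.

Lemma just_mono B B' (M M' : pred nat) x :
  B <= B' -> (forall z, M z -> M' z) -> just B M x -> just B' M' x.
Proof.
move=> BB MM.
move=> /bexP [a Ha /bexP [b Hb /bexP [c Hc /bexP [d Hd /bexP [e He /bexP [f Hf H]]]]]].
apply: (@bex6I _ _ a b c d e f); last exact: rules_mono H.
by rewrite !(leq_trans _ BB).
Qed.

(** Lists of judgements are easy to unite, and [just_mono] keeps them justified. Only [univP] turns
    such a list into a number [W]. *)
Definition derivable x := exists B (s : seq nat),
  x \in s /\ forall z, z \in s -> just B (mem s) z.

Lemma derivable_all (ps : seq nat) : (forall x, x \in ps -> derivable x) ->
  exists B (s : seq nat), {subset ps <= s} /\ forall z, z \in s -> just B (mem s) z.
Proof.
elim: ps => [|x ps IH] H; first by exists 0, (Nil nat).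
have [B1 [s1 [sub1 H1]]] : exists B (s : seq nat), {subset ps <= s} /\
    forall z, z \in s -> just B (mem s) z.
  by apply: IH => z Hz; apply: H; rewrite inE Hz orbT.
have [B2 [s2 [x2 H2]]] := H x (mem_head _ _).
exists (maxn B1 B2), (s1 ++ s2); split.
  by move=> z; rewrite inE mem_cat => /orP [/eqP ->|/sub1 ->] //; rewrite x2 orbT.
move=> z; rewrite mem_cat => /orP [/H1|/H2]; apply: just_mono; rewrite ?leq_maxl ?leq_maxr //;
  by move=> y /=; rewrite mem_cat => ->; rewrite ?orbT.
Qed.

(** The list [ps] holds the premises, and [a] to [f] instantiate the variables of the rule. The
    argument [B] serves the bounded quantifier inside the rule for [PMu]. *)
Lemma derivableI a b c d e f B (ps : seq nat) x : (forall z, z \in ps -> derivable z) ->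
  (forall M : pred nat, (forall z, z \in ps -> M z) -> rules B M x a b c d e f) ->
  derivable x.
Proof.
move=> /derivable_all [B1 [s [sub H]]] R.
pose B' := a + b + c + d + e + f + B + B1 + 1.
exists B', (x :: s); split; first exact: mem_head.
have sub' z : z \in s -> mem (x :: s) z by rewrite /= inE => ->; rewrite orbT.
move=> z; rewrite inE => /orP [/eqP ->|/H]; last by apply: just_mono; rewrite // /B'; lia.
apply: (@bex6I _ _ a b c d e f); first by rewrite /B'; lia.
apply: rules_mono (R (mem (x :: s)) _) => //; first by rewrite /B'; lia.
by move=> y /sub /sub'.
Qed.

Tactic Notation "rule" integer(k) :=
  let M := fresh "M" in let HM := fresh "HM" in
  move=> M HM; rewrite /rules; do k (apply/orP; right); try (apply/orP; left);
  repeat (apply/andP; split); first [exact: eqxx|by apply: HM; rewrite !inE eqxx ?orbT].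

Lemma derivable_nth v i : derivable (jud 2 (cs v) i (nth 0 v i)).
Proof.
elim: v i => [|h v IH] i /=.
  by apply: (@derivableI i 0 0 0 0 0 0 [::]) => //; rewrite nth_nil; rule 0.
case: i => [|i] /=.
  by apply: (@derivableI h (cs v) 0 0 0 0 0 [::]) => //; rule 1.
apply: (@derivableI h (cs v) i (nth 0 v i) 0 0 0 [:: jud 2 (cs v) i (nth 0 v i)]).
  by move=> z; rewrite inE => /eqP ->.
by rule 2.
Qed.

Lemma derivable_evals gs v :
  (forall g, List.In g gs -> forall y, peval g v y -> derivable (jud 0 (cprf g) (cs v) y)) ->
  forall ys, pevals gs v ys -> derivable (jud 1 (cs (map cprf gs)) (cs v) (cs ys)).
Proof.
elim: gs => [|g gs IH] Hg ys H; inversion H as [|? ? ? y ys' Hy Hys]; subst.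
  by apply: (@derivableI (cs v) 0 0 0 0 0 0 [::]) => //; rule 3.
apply: (@derivableI (cprf g) (cs (map cprf gs)) (cs v) y (cs ys') 0 0
  [:: jud 0 (cprf g) (cs v) y; jud 1 (cs (map cprf gs)) (cs v) (cs ys')]).
  move=> z; rewrite !inE => /orP [] /eqP ->; first by apply: Hg => //; left.
  by apply: IH => // h Hh; apply: Hg; right.
by rule 4.
Qed.

Lemma derivable_eval p v y : peval p v y -> derivable (jud 0 (cprf p) (cs v) y).
Proof.
elim/prf_nested_ind: p v y => [| |i|f gs IHf IHgs|f g IHf IHg|f IHf] v y H.
- inversion H; subst.
  by apply: (@derivableI (cs v) 0 0 0 0 0 0 [::]) => //; rule 5.
- inversion H; subst.
  apply: (@derivableI (cs v) (nth 0 v 0) 0 0 0 0 0 [:: jud 2 (cs v) 0 (nth 0 v 0)]).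
    by move=> z; rewrite inE => /eqP ->; apply: derivable_nth.
  by rule 6.
- inversion H; subst.
  apply: (@derivableI i (cs v) (nth 0 v i) 0 0 0 0 [:: jud 2 (cs v) i (nth 0 v i)]).
    by move=> z; rewrite inE => /eqP ->; apply: derivable_nth.
  by rule 7.
- inversion H as [| | |? ? ? ys ? Hys Hfy| | |]; subst.
  apply: (@derivableI (cprf f) (cs (map cprf gs)) (cs v) y (cs ys) 0 0
    [:: jud 1 (cs (map cprf gs)) (cs v) (cs ys); jud 0 (cprf f) (cs ys) y]).
    move=> z; rewrite !inE => /orP [] /eqP ->; last exact: IHf.
    by apply: derivable_evals => // g Hg z'; apply: IHgs.
  by rule 8.
- case: v H => [|n v] H; first by inversion H.
  elim: n y H => [|n IHn] y H; inversion H as [| | | |? ? ? ? H0|? ? ? ? a ? Ha Hga|]; subst.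
    apply: (@derivableI (cprf f) (cprf g) (cs v) y 0 0 0 [:: jud 0 (cprf f) (cs v) y]).
      by move=> z; rewrite inE => /eqP ->; apply: IHf.
    by rule 9.
  apply: (@derivableI (cprf f) (cprf g) n (cs v) y a 0
    [:: jud 0 (cprf (PPrec f g)) (cs (n :: v)) a; jud 0 (cprf g) (cs [:: n, a & v]) y]).
    by move=> z; rewrite !inE => /orP [] /eqP ->; [apply: IHn|apply: IHg].
  by rule 10.
- inversion H as [| | | | | |? ? ? Hy0 Hym]; subst.
  (* The rule for [PMu] bounds the nonzero values below [y] uniformly, so a common bound for these
     finitely many values is found first. *)
  have [K HK] : exists K, forall m, m < y -> exists2 k, k < K & peval f (m :: v) k.+1.
    move: (y) Hym {H Hy0}; elim=> [|n IHn] Hym; first by exists 0.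
    have [m Hm|K HK] := IHn; first by apply: Hym; lia.
    have [k Hk] := Hym n (ltnSn n).
    exists (K + k.+1) => m; rewrite ltnS leq_eqVlt => /orP [/eqP ->|/HK [k' Hk' Hp]].
      by exists k => //; lia.
    by exists k' => //; lia.
  have [ps Hps HM] : exists2 ps : seq nat, (forall z, z \in ps -> derivable z) &
      forall m, m < y -> exists2 k, k < K & jud 0 (cprf f) (cs (m :: v)) k.+1 \in ps.
    move: (y) HK {H Hy0 Hym}; elim=> [|n IHn] HK; first by exists [::].
    have [m Hm|ps Hps HM] := IHn; first by apply: HK; lia.
    have [k Hk Hp] := HK n (ltnSn n).
    exists (jud 0 (cprf f) (cs (n :: v)) k.+1 :: ps).
      by move=> z; rewrite inE => /orP [/eqP ->|/Hps //]; apply: IHf.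
    move=> m; rewrite ltnS leq_eqVlt => /orP [/eqP ->|/HM [k' Hk' Hin]].
      by exists k => //; apply: mem_head.
    by exists k' => //; rewrite inE Hin orbT.
  apply: (@derivableI (cprf f) (cs v) y 0 0 0 K (jud 0 (cprf f) (cs (y :: v)) 0 :: ps)).
    by move=> z; rewrite inE => /orP [/eqP ->|/Hps //]; apply: IHf.
  move=> M MH; rewrite /rules; do 11 (apply/orP; right).
  apply/and3P; split; [exact: eqxx|by apply: MH; apply: mem_head|].
  apply/ballP => m /HM [k Hk Hin].
  by apply/bexP; exists k => //; apply: MH; rewrite inE Hin orbT.
Qed.

Lemma univP p n : (exists y, peval p [:: n] y) <-> exists w, univ (cprf p) n w.
Proof.
split=> [[y /derivable_eval [B [s [Hs Hj]]]]|[w]]; last first.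
  case/bexP => B _ /bexP [W _ /bexP [y _ /andP [/ballP Hc Hm]]].
  have Hj x (Hx : mem_code B W x) : just B (mem_code B W) x.
    by apply: (implyP (Hc x _)) => //; case/andP: Hx.
  by exists y; apply: (sound_eval (v := [:: n]) Hj Hm).
(* [B'] exceeds every member of [s], so the digits of [W] below position [B'] describe [s]
   exactly. *)
pose B' := B + \max_(z <- s) z.+1.
pose W := lvl (fun z => z \in s) B'.
have ltB z : z \in s -> z < B'.
  move=> Hz; apply: leq_trans (leq_addl _ _).
  exact: (leq_bigmax_seq (r := s) (P := xpredT) (F := S)).
have memE z : mem_code B' W z = (z \in s).
  rewrite /mem_code; case: ltnP => Hz /=; first by rewrite lvl_bit.
  by apply/esym; apply/negP => /ltB; lia.
exists (B' + W + y).+1; apply/bexP; exists B'; first by lia.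
apply/bexP; exists W; first by lia.
apply/bexP; exists y; first by lia.
rewrite memE Hs andbT; apply/ballP => x _; apply/implyP; rewrite memE => /Hj.
by apply: just_mono; [rewrite /B'; lia|move=> z /=; rewrite memE].
Qed.

(* Indices can be padded: composing a program with a projection enlarges its code. *)
Lemma ce_univ A j : ce A -> exists2 e, j <= e & forall n, A n <-> exists w, univ e n w.
Proof.
case=> p Hp.
have [q Hq Hj] : exists2 q, (forall n, A n <-> exists y, peval q [:: n] y) & j <= cprf q.
  elim: j => [|j [q Hq Hj]]; first by exists p.
  exists (PComp (PProj 0) [:: q]).
    move=> n; rewrite Hq; split=> -[y H].
      exists y; apply: (@ev_comp _ _ _ [:: y] y); last exact: (ev_proj 0 [:: y]).
      by constructor; [exact: H|constructor].
    inversion H as [| | |? ? ? ys ? Hys _| | |]; subst.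
    by inversion Hys as [|? ? ? a ys' Ha _]; subst; exists a.
  apply: (leq_ltn_trans Hj) => /=.
  set c := cprf q.
  have := ltn_cc c 0; have := ltn_cc (cc c 0) 0; have := ltn_cc (cc 2 (cc 0 0)) (cc (cc c 0) 0).
  have := ltn_cc 3 (cc (cc 2 (cc 0 0)) (cc (cc c 0) 0)); lia.
by exists (cprf q) => // n; rewrite Hq univP.
Qed.

(** * Compactness and counting in Cantor space *)

Implicit Type c : nat -> nat -> bool.

(* [lvl X t] codes the first [t] bits of [X], so [c] decides membership level by level. *)
Definition level_open c : cset := fun X => exists t, c t (lvl X t).

(** The part of [level_open c] seen by level [T], as a set of strings of length [T]; [x %% 2 ^ t] is
    the prefix of length [t]. *)
Definition upto c T x := bex T.+1 (fun t => c t (x %% 2 ^ t)).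

Lemma mod_mod2 x l t : l <= t -> (x %% 2 ^ t) %% 2 ^ l = x %% 2 ^ l.
Proof. by move=> lt; rewrite modn_dvdm // dvdn_exp2l. Qed.

Lemma upto_mono c T T' x : T <= T' -> upto c T (x %% 2 ^ T) -> upto c T' x.
Proof.
move=> TT /bexP [t Ht H]; apply/bexP; exists t; first by lia.
by rewrite mod_mod2 in H.
Qed.

Lemma upto_opn c T X : upto c T (lvl X T) -> level_open c X.
Proof. by case/bexP => t Ht; rewrite lvl_mod // => H; exists t. Qed.

Lemma opn_upto c T X t : t <= T -> c t (lvl X t) -> upto c T (lvl X T).
Proof. by move=> tT H; apply/bexP; exists t; rewrite ?ltnS ?lvl_mod. Qed.

(** The cylinder of the string [y] of length [t] has a finite subcover, complete at level [T]. *)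
Definition covered c t y := exists T, t <= T /\
  forall x, x < 2 ^ T -> x %% 2 ^ t = y -> upto c T x.

Lemma coveredS c t y :
  covered c t.+1 y -> covered c t.+1 (y + 2 ^ t) -> covered c t y.
Proof.
move=> [T1 [tT1 H1]] [T2 [tT2 H2]]; exists (maxn T1 T2); split; first by lia.
move=> x _ xy.
(* The bit of [x] at position [t] tells which of the two children of [y] it extends. *)
have Hr b T : t < T -> b = odd (x %/ 2 ^ t) -> (x %% 2 ^ T) %% 2 ^ t.+1 = y + b * 2 ^ t.
  move=> tT ->; rewrite mod_mod2 //.
  by rewrite -lvl_bits lvlS lvl_bits xy.
case Eb : (odd (x %/ 2 ^ t)).
  apply: (@upto_mono _ T2); [exact: leq_maxr|apply: H2; first by rewrite ltn_mod expn_gt0].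
  by rewrite (Hr true) // mul1n.
apply: (@upto_mono _ T1); [exact: leq_maxl|apply: H1; first by rewrite ltn_mod expn_gt0].
by rewrite (Hr false) // mul0n addn0.
Qed.

Fixpoint path_code c t := match t with
  | 0 => 0
  | t.+1 => if excluded_middle_informative (covered c t.+1 (path_code c t))
            then path_code c t + 2 ^ t else path_code c t
  end.

Definition path c t : bool :=
  if excluded_middle_informative (covered c t.+1 (path_code c t)) then true else false.

Lemma lvl_path c t : lvl (path c) t = path_code c t.
Proof.
elim: t => [|t IH]; first by rewrite /lvl big_ord0.
by rewrite lvlS IH /path /=; case: excluded_middle_informative => h; rewrite ?mul1n ?addn0.
Qed.

(* If the whole tree is not covered at a finite level, the path that always leaves
   through an uncovered child avoids the open set. *)
Lemma fan c : (forall X, level_open c X) -> exists T, forall x, x < 2 ^ T -> upto c T x.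
Proof.
move=> H.
have [[T [_ HT]]|N] := excluded_middle_informative (covered c 0 0).
  by exists T => x Hx; apply: HT => //; rewrite modn1.
have {}N t : ~ covered c t (path_code c t).
  elim: t => //= t IH; case: excluded_middle_informative => // H1 H2.
  by apply: IH; apply: coveredS.
have [t Ht] := H (path c); case: (N t); exists t; split=> // x Hx.
rewrite modn_small // => E; rewrite E -lvl_path.
exact: opn_upto Ht.
Qed.

Lemma fan_at c (Q : pred nat) N : (forall X, Q (lvl X N) -> level_open c X) ->
  exists T, N <= T /\ forall x, x < 2 ^ T -> Q (x %% 2 ^ N) -> upto c T x.
Proof.
(* Adding the strings of length [N] outside [Q] gives a cover of the whole space, to which [fan]
   applies. *)
move=> H; pose c' t y := c t y || ((t == N) && ~~ Q y).
have [|T HT] := @fan c'.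
  move=> X; case: (boolP (Q (lvl X N))) => [/H [t Ht]|HQ].
    by exists t; rewrite /c' Ht.
  by exists N; rewrite /c' eqxx HQ orbT.
exists (maxn N T); split=> [|x Hx HQ]; first exact: leq_maxl.
apply: (upto_mono (leq_maxr N T)).
have /bexP [t Ht] := HT (x %% 2 ^ T) ltac:(by rewrite ltn_mod expn_gt0).
rewrite mod_mod2 // => /orP [Hc|/andP [/eqP E]]; last by rewrite E HQ.
by apply/bexP; exists t => //; rewrite mod_mod2.
Qed.

(** * Codes of strings and effectively open sequences *)

Definition code_val (s : seq bool) := lvl (nth false s) (size s).

(** [code_str] puts a leading digit 1 above the binary value of the string; this digit records the
    length. *)
Lemma code_strE s : code_str s = 2 ^ size s + code_val s.
Proof.
rewrite /code_val; elim: s => [|b s IH]; first by rewrite /lvl big_ord0.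
rewrite /= {}IH -[(size s).+1]add1n lvlD expnD expn1.
rewrite (_ : lvl _ 1 = b); last by rewrite /lvl big_ord1 muln1.
by rewrite -mul2n mulnDr addnA addnAC addnA.
Qed.

Lemma cylP s X : cyl s X <-> lvl X (size s) = code_val s.
Proof. by split=> [H|]; [apply: eq_lvl|apply: lvl_eq]. Qed.

Definition str n y := mkseq (bits y) n.

Lemma size_str n y : size (str n y) = n. Proof. exact: size_mkseq. Qed.

Lemma code_val_str n y : code_val (str n y) = y %% 2 ^ n.
Proof.
rewrite /code_val size_str -lvl_bits; apply: eq_lvl => k kn; exact: nth_mkseq.
Qed.

Lemma str_code_val s : str (size s) (code_val s) = s.
Proof.
apply: (@eq_from_nth _ false); first by rewrite size_str.
by move=> k; rewrite size_str => kn; rewrite nth_mkseq // /bits /code_val lvl_bit.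
Qed.

Lemma code_str_inj : injective code_str.
Proof.
move=> s s'; rewrite !code_strE => E.
have := lvl_lt (nth false s) (size s); have := lvl_lt (nth false s') (size s').
rewrite -/(code_val s) -/(code_val s') => H1 H2.
have e : size s = size s'.
  case: (ltngtP (size s) (size s')) => // h; exfalso.
    by have := @leq_pexp2l 2 _ _ isT h; rewrite expnS; lia.
  by have := @leq_pexp2l 2 _ _ isT h; rewrite expnS; lia.
rewrite -[s]str_code_val -[s']str_code_val e.
by congr str; rewrite e in E; lia.
Qed.

Lemma prefixE s t : prefix s t = (size s <= size t) && (code_val t %% 2 ^ size s == code_val s).
Proof.
case: leqP => [st|ts]; last first.
  by apply/negP => /size_prefix; lia.
rewrite prefixE /code_val lvl_mod //=; apply/eqP/eqP => [E|E].
  by apply: eq_lvl => k ks; rewrite -[in RHS]E nth_take.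
apply: (@eq_from_nth _ false); first by rewrite size_takel.
by move=> k; rewrite size_takel // => ks; rewrite nth_take //; apply: (lvl_eq E).
Qed.

(** All cylinders included in the open set must be enumerated, not only those accepted by [c]. By
    compactness an inclusion shows at a finite level, and checking one level is a bounded search. *)
Lemma unif_eff_open_opn (c : nat -> nat -> nat -> bool) :
  cfun 3 (fun v => nat_of_bool (c (nth 0 v 0) (nth 0 v 1) (nth 0 v 2))) ->
  unif_eff_open (fun i => level_open (c i)).
Proof.
move=> Hc; split=> [i X [t Ht]|].
  exists (str t (lvl X t)).
  have sz := size_str t (lvl X t).
  split; first by apply/cylP; rewrite code_val_str sz modn_small // lvl_lt.
  move=> Y /cylP; rewrite code_val_str sz modn_small ?lvl_lt // => E.
  by exists t; rewrite E.
(* [l] and [z] are the length and value of the string, [k] is the number of further levels examined,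
   and [w] bounds all of these. *)
pose P n w := bex w (fun i => bex w (fun l => bex w (fun z => bex w (fun k =>
  [&& n == cpair i (2 ^ l + z), z.+1 <= 2 ^ l &
    ball (2 ^ (l + k)) (fun x => (x %% 2 ^ l == z) ==>
      bex (l + k).+1 (fun t => c i t (x %% 2 ^ t)))])))).
apply: (@ce_cfun _ P).
  rewrite /P.
  have H n g1 g2 g3 := cfun_app3 (n := n) (f := fun i t y => c i t y : nat)
    (g1 := g1) (g2 := g2) (g3 := g3) Hc.
  cfun_tac; apply: H; cfun_tac.
move=> n; split.
  case=> i [s [-> Hs]].
  have [|T [sT HT]] := @fan_at (c i) (fun y => y == code_val s) (size s).
    by move=> X /eqP E; apply: Hs; apply/cylP.
  pose w := (i + size s + code_val s + T).+1; exists w.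
  apply/bexP; exists i; first by rewrite /w; lia.
  apply/bexP; exists (size s); first by rewrite /w; lia.
  apply/bexP; exists (code_val s); first by rewrite /w; lia.
  apply/bexP; exists (T - size s); first by rewrite /w; lia.
  rewrite code_strE eqxx lvl_lt subnKC //=.
  apply/ballP => x Hx; apply/implyP; exact: HT.
case=> w /bexP [i _ /bexP [l _ /bexP [z _ /bexP [k _ /and3P [/eqP -> zl /ballP H]]]]].
exists i, (str l z); rewrite code_strE size_str code_val_str modn_small //; split=> // X.
move=> /cylP; rewrite code_val_str size_str modn_small // => E.
apply: (@upto_opn _ (l + k)); apply: (implyP (H _ (lvl_lt _ _))).
by rewrite lvl_mod ?leq_addr // E.
Qed.

(** * Counting strings and Lebesgue measure *)

Lemma sum_nat_split n (F : nat -> nat) :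
  \sum_(x < 2 * n) F x = \sum_(x < n) F x + \sum_(x < n) F (x + n).
Proof.
rewrite mul2n -addnn big_split_ord /=; congr addn.
by apply: eq_bigr => i _; rewrite addnC.
Qed.

Lemma sum_nat_parity n (F : nat -> nat) :
  \sum_(x < 2 * n) F x = \sum_(x < n) F (2 * x) + \sum_(x < n) F (2 * x + 1).
Proof.
elim: n => [|n IH]; first by rewrite muln0 !big_ord0.
rewrite (_ : 2 * n.+1 = (2 * n).+2); last by lia.
by rewrite 4!big_ord_recr /= IH -addnA addnACA addn1.
Qed.

Lemma leq_cnt T (P Q : pred nat) : (forall x, x < 2 ^ T -> P x -> Q x) -> cnt T P <= cnt T Q.
Proof.
move=> H; apply: leq_sum => x _; case: (boolP (P x)) => // Px.
by rewrite (H x _ Px).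
Qed.

Lemma eq_cnt T (P Q : pred nat) : (forall x, x < 2 ^ T -> P x = Q x) -> cnt T P = cnt T Q.
Proof. by move=> H; apply: eq_bigr => x _; rewrite H. Qed.

Lemma cnt_lift N k P : cnt (N + k) (fun x => P (x %% 2 ^ N)) = 2 ^ k * cnt N P.
Proof.
elim: k => [|k IH].
  by rewrite addn0 mul1n; apply: eq_cnt => x Hx; rewrite modn_small.
rewrite addnS /cnt expnS (sum_nat_split _ (fun x => P (x %% 2 ^ N) : nat)).
rewrite [X in _ + X](eq_bigr (fun x : 'I__ => P (x %% 2 ^ N) : nat)).
  by rewrite addnn -mul2n -/(cnt _ (fun x => P (x %% 2 ^ N))) IH mulnA -expnS.
by move=> x _; move: (x : nat) => y; rewrite expnD mulnC addnC modnMDl.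
Qed.

(** The condition [x < 2 ^ m] says that the last [k] digits of a string of length [m + k] are
    zero. *)
Lemma cnt_small m k (A : pred nat) : cnt (m + k) (fun x => (x < 2 ^ m) && A x) = cnt m A.
Proof.
rewrite /cnt (big_ord_widen_cond (2 ^ (m + k)) xpredT (fun x => A x : nat)); last first.
  by rewrite leq_pexp2l ?leq_addr.
rewrite [RHS]big_mkcond /=; apply: eq_bigr => x _.
by case: (_ < _).
Qed.

Lemma cntU T (P Q : pred nat) : cnt T (fun x => P x || Q x) <= cnt T P + cnt T Q.
Proof. by rewrite -big_split; apply: leq_sum => x _; case: (P x); case: (Q x). Qed.

Lemma cnt_bex T K (P : nat -> pred nat) :
  cnt T (fun x => bex K (P^~ x)) <= \sum_(e < K) cnt T (P e).
Proof.
rewrite exchange_big; apply: leq_sum => x _.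
case: bexP => // -[e He Pe]; rewrite (bigD1 (Ordinal He)) //= Pe; lia.
Qed.

Lemma count_allstr n (P : pred (seq bool)) :
  count P (allstr n) = cnt n (fun y => P (str n y)).
Proof.
elim: n P => [|n IH] P; first by rewrite /cnt /= big_ord1 addn0.
rewrite /= cats0 count_cat !count_map !IH /cnt expnS.
(* [allstr] branches on the first bit, which is the lowest digit of the code, so the sum is split by
   parity. *)
rewrite (sum_nat_parity _ (fun y => P (str n.+1 y) : nat)).
have E (b : bool) x : str n.+1 (2 * x + b) = b :: str n x.
  rewrite /str /mkseq /= /bits divn1 (iotaDl 1 0) -map_comp.
  congr cons; first by rewrite oddD mul2n odd_double; case: b.
  apply: eq_map => k /=; congr odd.
  by rewrite add1n expnS divnMA (mulnC 2) divnMDl // (@divn_small b) ?addn0 //; case: b.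
by congr addn; apply: eq_bigr => x _; rewrite /= -(E) ?addn0.
Qed.

Import Order.TTheory GRing.Theory Num.Theory.

Lemma lam_finE (F : seq (seq bool)) n a : (\max_(s <- F) size s = a)%N ->
  (lam_fin F <= ((2 ^ n)%:R)^-1)%R =
  (cnt a (fun y => has (fun s => prefix s (str a y)) F) * 2 ^ n <= 2 ^ a)%N.
Proof.
move=> Ea; rewrite /lam_fin Ea count_allstr.
rewrite ler_pdivrMr ?ltr0n ?expn_gt0 // mulrC ler_pdivlMr ?ltr0n ?expn_gt0 //.
by rewrite -natrM ler_nat.
Qed.

(** A finite family of cylinders inside the open set is covered at one level [T] by compactness;
    lifting its count to length [T] makes the hypothesis applicable. *)
Lemma lam_le_opn c n :
  (forall T, cnt T (upto c T) * 2 ^ n <= 2 ^ T) -> lam_le (level_open c) ((2 ^ n)%:R^-1)%R.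
Proof.
move=> H F HF; rewrite (lam_finE _ erefl).
set N := \max_(s <- F) size s.
set Q := fun y => has _ F.
have szF s : s \in F -> size s <= N.
  by move=> Hs; apply: (leq_bigmax_seq (r := F) (P := xpredT) (F := size)).
have [|T [NT HT]] := @fan_at c Q N.
  move=> X /hasP [s Hs]; rewrite prefixE size_str szF //= code_val_str mod_mod2 ?szF //.
  rewrite lvl_mod ?szF // => /eqP E.
  by apply: (HF s Hs); apply/cylP.
have E := cnt_lift N (T - N) Q; rewrite subnKC // in E.
have H1 : cnt T (fun x => Q (x %% 2 ^ N)) <= cnt T (upto c T) by apply: leq_cnt.
rewrite -(leq_pmul2l (m := 2 ^ (T - N))) ?expn_gt0 // mulnA -E -expnD subnK //.
by apply: leq_trans (H T); rewrite leq_pmul2r ?expn_gt0.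
Qed.

(** This will show that the cut-off in [test_trunc] leaves genuine tests intact. *)
Lemma cnt_lam_le (U : cset) n t (P : pred nat) : lam_le U ((2 ^ n)%:R^-1)%R ->
  (forall X, P (lvl X t) -> U X) -> cnt t P * 2 ^ n <= 2 ^ t.
Proof.
move=> HU HP.
(* If no string satisfies [P], the family [F] below would be empty and [lam_fin] would count at
   length 0 instead of [t]; this case is separate. *)
case: (boolP (has P (iota 0 (2 ^ t)))) => [/hasP [y0 Hy0 Py0]|N]; last first.
  rewrite (_ : cnt t P = 0) ?mul0n //; apply/eqP; rewrite sum_nat_eq0.
  apply/forallP => x /=; rewrite eqb0; move/hasPn: N; apply.
  by rewrite mem_iota /= add0n.
pose F := [seq str t y | y <- iota 0 (2 ^ t) & P y].
have szF : \max_(s <- F) size s = t.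
  apply/anti_leq/andP; split.
    by apply/bigmax_leqP_seq => s /mapP [y _ ->] _; rewrite size_str.
  rewrite -[X in X <= _](size_str t y0).
  apply: (leq_bigmax_seq (r := F) (P := xpredT) (F := size)) => //.
  by apply: map_f; rewrite mem_filter Py0.
have : (lam_fin F <= (2 ^ n)%:R^-1)%R.
  apply: HU => s /mapP [y]; rewrite mem_filter mem_iota /= add0n => /andP [Py Hy] ->.
  by move=> X /cylP; rewrite size_str code_val_str modn_small // => E; apply: HP; rewrite E.
rewrite (lam_finE _ szF); apply: leq_trans; rewrite leq_pmul2r ?expn_gt0 //.
apply: leq_cnt => y Hy Py; apply/hasP; exists (str t y); last exact: prefix_refl.
by apply: map_f; rewrite mem_filter Py mem_iota.
Qed.

(** * The two tests *)

(** The number [2 ^ l + y %% 2 ^ l] is the code of the prefix of [y] of length [l]. The level [t]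
    also bounds the witness [w], which makes each level decidable. *)
Definition test_enum e n t y :=
  bex t.+1 (fun l => bex t.+1 (fun w => univ e (cpair n (2 ^ l + y %% 2 ^ l)) w)).

Lemma test_enum_mono e n t t' y : t <= t' -> test_enum e n t (y %% 2 ^ t) -> test_enum e n t' y.
Proof.
move=> tt /bexP [l Hl /bexP [w Hw H]].
apply/bexP; exists l; first by lia.
apply/bexP; exists w; first by lia.
by rewrite mod_mod2 in H.
Qed.

(* The cut-off keeps the measure below [2^-n] and never acts when [e] enumerates a test. *)
Definition test_trunc e n t y := test_enum e n t y && (cnt t (test_enum e n t) * 2 ^ n <= 2 ^ t).

(** If the enumeration at a level is within the bound, it contains all that was accepted so far. If
    not, that level accepts nothing and the bound of the previous level carries over. *)
Lemma cnt_test_trunc e n T : cnt T (upto (test_trunc e n) T) * 2 ^ n <= 2 ^ T.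
Proof.
have small t : cnt t (test_enum e n t) * 2 ^ n <= 2 ^ t ->
    cnt t (upto (test_trunc e n) t) * 2 ^ n <= 2 ^ t.
  move=> H; apply: leq_trans H; rewrite leq_pmul2r ?expn_gt0 //.
  by apply: leq_cnt => x _ /bexP [k Hk /andP [He _]]; apply: test_enum_mono He.
have dec t : cnt t (test_enum e n t) * 2 ^ n <= 2 ^ t \/ 2 ^ t < cnt t (test_enum e n t) * 2 ^ n.
  by apply/orP; rewrite leqNgt orNb.
elim: T => [|T IH].
  have [/small //|H] := dec 0.
  rewrite (_ : cnt _ _ = 0) //; apply/eqP; rewrite sum_nat_eq0.
  apply/forallP => x; apply/implyP => _; rewrite eqb0; apply/negP => /bexP [t].
  by rewrite ltnS leqn0 => /eqP -> /andP [_]; rewrite leqNgt H.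
have [/small //|H] := dec T.+1.
have : cnt T.+1 (upto (test_trunc e n) T.+1) <= 2 ^ 1 * cnt T (upto (test_trunc e n) T).
  rewrite -cnt_lift addn1; apply: leq_cnt => x _ /bexP [t].
  rewrite ltnS leq_eqVlt => /orP [/eqP ->|tT]; first by rewrite /test_trunc leqNgt H andbF.
  by move=> Ht; apply/bexP; exists t => //; rewrite mod_mod2.
by rewrite expn1 [2 ^ T.+1]expnS; nia.
Qed.

(** * All-zero blocks *)

Definition block j := 2 ^ j.+1.

Lemma blockS j : block j.+1 = block j + block j.
Proof. by rewrite /block expnS mul2n addnn. Qed.

Lemma leq_block i j : (block i <= block j) = (i <= j).
Proof. by rewrite leq_exp2l. Qed.

Lemma ltn_block i j : (block i < block j) = (i < j).
Proof. by rewrite ltn_exp2l. Qed.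

Lemma ltn_block_id j : j < block j.
Proof. by rewrite (ltn_trans (ltnSn j)) // ltn_expl. Qed.

(** The digits of [y] at positions [m] to [2 * m - 1] are all zero. *)
Definition zero_block m y := y %% 2 ^ (m + m) < 2 ^ m.

Lemma zero_block_modE m t y : m + m <= t -> zero_block m (y %% 2 ^ t) = zero_block m y.
Proof. by move=> H; rewrite /zero_block mod_mod2. Qed.

(** No bound on [t] is imposed: the digits missing from a short prefix read as zeros. *)
Lemma zero_block_mod m t y : zero_block m y -> zero_block m (y %% 2 ^ t).
Proof.
case: (leqP (m + m) t) => [mt|tm]; first by rewrite zero_block_modE.
rewrite /zero_block => H; apply: leq_ltn_trans H.
rewrite -(mod_mod2 y (ltnW tm)); apply: leq_trans (leq_mod _ _) _; exact: leq_mod.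
Qed.

Definition no_zero j y := ball j (fun l => ~~ zero_block (block l) y).
Definition first_zero j y := zero_block (block j) y && no_zero j y.

Lemma no_zeroE j t y : block j <= t -> no_zero j (y %% 2 ^ t) = no_zero j y.
Proof.
move=> jt; apply/ballP/ballP => H l lj; have := H l lj; rewrite zero_block_modE //;
  by rewrite -blockS; apply: leq_trans jt; rewrite leq_block.
Qed.

Lemma first_zeroE j t y : block j.+1 <= t -> first_zero j (y %% 2 ^ t) = first_zero j y.
Proof.
move=> jt; rewrite /first_zero zero_block_modE -?blockS // no_zeroE //.
by apply: leq_trans jt; rewrite leq_block.
Qed.

Lemma first_zero_mod j t y : block j <= t -> first_zero j y -> first_zero j (y %% 2 ^ t).
Proof. by move=> jt /andP [/(zero_block_mod t) H]; rewrite /first_zero H no_zeroE. Qed.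

(** Avoiding zeros in block [j] keeps the share [1 - 2 ^ (- block j)], and these factors multiply to
    more than 1/4. The summand 4 carries the induction and makes the final comparison strict. *)
Lemma cnt_no_zero j : 2 ^ block j + 4 <= 4 * cnt (block j) (no_zero j).
Proof.
elim: j => [|j IH].
  rewrite (@eq_cnt _ _ xpredT); last by move=> x _; apply/ballP.
  by rewrite /cnt sum1_card card_ord.
have := cntU (block j.+1) (no_zero j.+1) (fun y => (y < 2 ^ block j) && no_zero j y).
rewrite blockS cnt_small => HU.
have : 2 ^ block j * cnt (block j) (no_zero j) <=
    cnt (block j + block j) (fun x => no_zero j.+1 x || (x < 2 ^ block j) && no_zero j x).
  rewrite -cnt_lift; apply: leq_cnt => x Hx; rewrite no_zeroE // => Hj; rewrite Hj andbT.
  case: ltnP => Hm; rewrite ?orbT // orbF.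
  apply/ballP => l; rewrite ltnS leq_eqVlt => /orP [/eqP ->|lj]; last exact: (ballP _ _ Hj).
  by rewrite /zero_block modn_small // -leqNgt.
have : 2 ^ 2 <= 2 ^ block j by rewrite leq_exp2l // (@leq_pexp2l 2 1).
move: IH HU; rewrite expnD (_ : 2 ^ 2 = 4) //.
set M := 2 ^ _; set a := cnt _ (no_zero j); set b := cnt _ (no_zero j.+1); set z := cnt _ _.
by nia.
Qed.

Lemma cnt_first_zero j k :
  cnt (block j + block j + k) (first_zero j) = 2 ^ k * cnt (block j) (no_zero j).
Proof.
(* At length [2 * block j] the zeros of the block leave the number unchanged, so exactly the codes
   of [no_zero j] at length [block j] are counted. *)
rewrite -(cnt_small (block j) (block j)) -cnt_lift; apply: eq_cnt => x _.
by rewrite /first_zero -blockS no_zeroE ?leq_block // /zero_block -blockS.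
Qed.

(** The weights [2 ^ (- (e + i + 3))] sum to [2 ^ (- i - 2)], and the term [block e] compensates for
    the measure of the events with [j <= e]. As missing digits read as zeros, strings ending inside
    block [j] with only zeros there so far are rejected too. *)
Definition piece i e t y := test_trunc e (e + i + 3 + block e) t y &&
  ~~ bex t (fun j => [&& e < j, block j < t & first_zero j y]).

Definition univ_test i t y := bex t.+1 (fun e => piece i e t y).

Lemma cfun_univ_test :
  cfun 3 (fun v => nat_of_bool (univ_test (nth 0 v 0) (nth 0 v 1) (nth 0 v 2))).
Proof.
rewrite /univ_test /piece /first_zero /no_zero /zero_block /test_trunc /test_enum /block.
cfun_tac; apply: (cfun_app3 (f := fun e n w => univ e n w : nat) cfun_univ); cfun_tac.
Qed.

Lemma upto_univ_test i T x : upto (univ_test i) T x -> bex T.+1 (fun e => upto (piece i e) T x).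
Proof.
case/bexP => t Ht /bexP [e He H]; apply/bexP; exists e; first by lia.
by apply/bexP; exists t.
Qed.

Lemma cnt_piece i e T : cnt T (upto (piece i e) T) * 2 ^ (e + i + 3 + block e) <= 2 ^ T.
Proof.
apply: leq_trans (cnt_test_trunc e (e + i + 3 + block e) T); rewrite leq_pmul2r ?expn_gt0 //.
by apply: leq_cnt => x _ /bexP [t Ht /andP [H _]]; apply/bexP; exists t.
Qed.

(* For [e < j] a piece may meet the [j]-th block event only through strings shorter than
   [block j], and these are independent of that block. *)
Lemma cnt_piece_first_zero i e j k T : T = block j + block j + k ->
  cnt T (fun x => first_zero j x && upto (piece i e) T x) * 2 ^ (block j + e + i + 3) <= 2 ^ T.
Proof.
move=> ET; case: (leqP j e) => [je|ej].
  apply: leq_trans (cnt_piece i e T); apply: leq_mul.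
    by apply: leq_cnt => x _ /andP [].
  by rewrite leq_exp2l //; have := leq_block j e; rewrite je; lia.
set n := e + i + 3 + block e; set m := block j.
pose A y := upto (test_trunc e n) m (y %% 2 ^ m).
have : cnt T (fun x => first_zero j x && upto (piece i e) T x) <= 2 ^ k * cnt m A.
  rewrite ET -(cnt_small m m) -cnt_lift -ET; apply: leq_cnt => x _ /andP [Hx /bexP [t Ht]].
  case/andP=> Htr Hno.
  (* A prefix of [x] longer than [block j] still looks like a member of the event and is rejected by
     [piece]. *)
  have tm : t <= m.
    rewrite leqNgt; apply: contra Hno => mt; apply/bexP; exists j.
      exact: ltn_trans (ltn_block_id j) mt.
    by rewrite ej mt first_zero_mod // ltnW.
  have /andP [Hz _] := Hx; rewrite [X in X && _]Hz /A mod_mod2 ?leq_addr //.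
  by apply/bexP; exists t => //; rewrite mod_mod2.
rewrite (@eq_cnt _ A (upto (test_trunc e n) m)); last by move=> x Hx; rewrite /A modn_small.
have Hf : 2 ^ (e + i + 3) <= 2 ^ n by rewrite leq_exp2l // leq_addr.
have Hb := leq_trans (leq_mul (leqnn (cnt m (upto (test_trunc e n) m))) Hf) (cnt_test_trunc e n m).
rewrite (_ : m + e + i + 3 = m + (e + i + 3)); last by lia.
move: (cnt T _) (cnt m _) Hb => a b Hb Ha.
rewrite ET -/m !(expnD 2 (m + m)) !(expnD 2 m).
move: (2 ^ (e + i + 3)) (2 ^ m) (2 ^ k) Ha Hb => f M K Ha Hb.
apply: leq_trans (leq_mul Ha (leqnn (M * f))) _.
rewrite (_ : K * b * (M * f) = K * M * (b * f)); last by lia.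
by rewrite (_ : M * M * K = K * M * M) ?leq_mul2l ?Hb ?orbT //; lia.
Qed.

(** * Measure bounds for the two tests *)

Lemma sum_geometric K (a : nat -> nat) N : (forall e, a e * 2 ^ e.+1 <= N) ->
  \sum_(e < K) a e <= N.
Proof.
(* The strengthened claim is that the partial sum is at most [N * (1 - 2 ^ (- K))]. *)
move=> H; suff : (\sum_(e < K) a e) * 2 ^ K + N <= N * 2 ^ K.
  have M0 : 0 < 2 ^ K by rewrite expn_gt0.
  by move: (\sum_(_ < _) _) (2 ^ K) M0 => S M; nia.
elim: K => [|K IH]; first by rewrite big_ord0 expn0 !muln1.
rewrite big_ord_recr /=; have := H K; move: IH; rewrite expnS.
by move: (\sum_(_ < _) _) (2 ^ K) (a K) => S M b; nia.
Qed.

Lemma sum_geometric_mul K (a : nat -> nat) N d : (forall e, a e * 2 ^ (e.+1 + d) <= N) ->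
  (\sum_(e < K) a e) * 2 ^ d <= N.
Proof.
move=> H; rewrite big_distrl /=.
by apply: (@sum_geometric K (fun e => a e * 2 ^ d) N) => e; rewrite -mulnA -expnD addnC.
Qed.

Lemma lam_le_univ_test i : lam_le (level_open (univ_test i)) ((2 ^ i)%:R^-1)%R.
Proof.
apply: lam_le_opn => T.
apply: leq_trans (@sum_geometric_mul T.+1 (fun e => cnt T (upto (piece i e) T)) _ i _).
  rewrite leq_mul2r; apply/orP; right.
  apply: leq_trans (cnt_bex T T.+1 (fun e => upto (piece i e) T)).
  by apply: leq_cnt => x _; apply: upto_univ_test.
move=> e; apply: leq_trans (cnt_piece i e T); rewrite leq_mul2l leq_exp2l //; lia.
Qed.

Definition block_test j t y := (t == block j.+1) && first_zero j y.

Lemma cfun_block_test :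
  cfun 3 (fun w => nat_of_bool (block_test (nth 0 w 0) (nth 0 w 1) (nth 0 w 2))).
Proof. by rewrite /block_test /first_zero /no_zero /zero_block /block; cfun_tac. Qed.

Lemma lam_le_block_test j : lam_le (level_open (block_test j)) ((2 ^ j)%:R^-1)%R.
Proof.
apply: lam_le_opn => T.
case: (leqP (block j.+1) T) => [jT|Tj]; last first.
  rewrite (_ : cnt _ _ = 0) //; apply/eqP; rewrite sum_nat_eq0.
  apply/forallP => x; apply/implyP => _; rewrite eqb0; apply/negP => /bexP [t Ht /andP [/eqP E]].
  by move: Ht; rewrite E; lia.
set k := T - block j.+1; have ET : T = block j + block j + k by rewrite /k blockS subnKC -?blockS.
have : cnt T (upto (block_test j) T) <= cnt T (first_zero j).
  apply: leq_cnt => x _ /bexP [t Ht /andP [/eqP ->]]; by rewrite first_zeroE.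
have EC := cnt_first_zero j k; rewrite -ET in EC; rewrite EC => H.
have H1 : cnt (block j) (no_zero j) <= 2 ^ block j.
  rewrite -[X in _ <= X]card_ord -sum1_card; apply: leq_sum => x _; exact: leq_b1.
have H2 : 2 ^ j <= 2 ^ block j by rewrite leq_exp2l // ltnW // ltn_block_id.
have -> : 2 ^ T = 2 ^ block j * 2 ^ block j * 2 ^ k by rewrite ET !expnD.
move: (cnt T _) (cnt (block j) _) (2 ^ j) (2 ^ block j) (2 ^ k) H H1 H2 => a b J M K H H1 H2.
apply: leq_trans (leq_mul (leq_trans H (leq_mul (leqnn K) H1)) H2) _.
by rewrite mulnC mulnA mulnAC.
Qed.

(** * Universality and failure of inclusion *)

Lemma univ_test_universal V X i : ML_test V -> (forall n, V n X) -> level_open (univ_test i) X.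
Proof.
move=> [[Vopen Vce] Vlam] HX.
pose fz j := first_zero j (lvl X (block j.+1)).
have fzE j t : block j.+1 <= t -> first_zero j (lvl X t) = fz j.
  by move=> jt; rewrite /fz -(lvl_mod X jt) first_zeroE.
(* At most one block can be the first all-zero one, so the indices with [fz j] are bounded. *)
have [J HJ] : exists J, forall j, fz j -> j <= J.
  have [[J HJ]|N] := excluded_middle_informative (exists j, fz j); last first.
    by exists 0 => j Hj; case: N; exists j.
  exists J => j Hj; rewrite leqNgt; apply/negP => Jj.
  move: HJ; rewrite -(fzE J (block j.+1)) ?leq_block ?ltnS 1?ltnW // => /andP [Hz _].
  by move/andP: Hj => [_ /ballP /(_ J Jj)]; rewrite Hz.
have [e Je He] := ce_univ J Vce.
set n := e + i + 3 + block e.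
have [s [sX sV]] := Vopen n X (HX n).
have [w Hw] : exists w, univ e (cpair n (code_str s)) w by apply/He; exists n, s.
(* The level [t = block l] is large enough to see [e], [s] and [w]. Being a block boundary, it
   contains every block starting before it completely, so no block is misjudged. *)
pose l := e + size s + w.
have tl : l < block l := ltn_block_id l.
set t := block l in tl.
(* The strings enumerated so far lie inside [V n], so the measure of [V n] keeps the cut-off from
   acting. *)
have enumV Y : test_enum e n t (lvl Y t) -> V n Y.
  case/bexP => k Hk /bexP [w' _ Hw'].
  have : exists i s, cpair n (2 ^ k + lvl Y t %% 2 ^ k) = cpair i (code_str s) /\
      csubset (cyl s) (V i) by apply/He; exists w'.
  case=> n' [s' [/cpair_inj [<-]]]; rewrite lvl_mod // => E.
  have <- : str k (lvl Y k) = s'.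
    by apply: code_str_inj; rewrite -E code_strE size_str code_val_str modn_small ?lvl_lt.
  by apply; apply/cylP; rewrite size_str code_val_str modn_small // lvl_lt.
exists t; apply/bexP; exists e; first by rewrite /l in tl; lia.
apply/andP; split; last first.
  apply/negP => /bexP [j _ /and3P [ej jt]].
  rewrite fzE => [/HJ|]; first by lia.
  by rewrite leq_block; rewrite ltn_block in jt.
apply/andP; split; last by apply: cnt_lam_le (Vlam n) enumV.
apply/bexP; exists (size s); first by rewrite /l in tl; lia.
apply/bexP; exists w; first by rewrite /l in tl; lia.
rewrite lvl_mod; last by rewrite /l in tl; lia.
by move/cylP: sX => ->; rewrite -code_strE.
Qed.

(** Compactness turns an inclusion into a covering at one level [T]. Within the event, piece [e]
    covers at most the share [2 ^ (- (block j + e + 3))] of all strings, in total at most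
    [2 ^ (- (block j + 2))]; by [cnt_no_zero] the event has a strictly larger share. *)
Lemma block_test_not_sub j : ~ csubset (level_open (block_test j)) (level_open (univ_test 0)).
Proof.
move=> sub.
have [|T [jT HT]] := @fan_at (univ_test 0) (first_zero j) (block j.+1).
  by move=> X HX; apply: sub; exists (block j.+1); rewrite /block_test eqxx.
set k := T - block j.+1; have ET : T = block j + block j + k by rewrite /k blockS subnKC -?blockS.
pose P e x := first_zero j x && upto (piece 0 e) T x.
have H1 : cnt T (first_zero j) <= \sum_(e < T.+1) cnt T (P e).
  apply: leq_trans (cnt_bex T T.+1 P); apply: leq_cnt => x Hx Hj.
  have /upto_univ_test /bexP [e He H] : upto (univ_test 0) T x.
    by apply: HT => //; rewrite first_zeroE.
  by apply/bexP; exists e => //; rewrite /P Hj.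
have H2 : (\sum_(e < T.+1) cnt T (P e)) * 2 ^ (block j + 2) <= 2 ^ T.
  apply: (@sum_geometric_mul T.+1 (fun e => cnt T (P e))) => e.
  have := cnt_piece_first_zero 0 e ET.
  by rewrite (_ : e.+1 + (block j + 2) = block j + e + 0 + 3); last by lia.
have H3 := cnt_no_zero j.
have EC := cnt_first_zero j k; rewrite -ET in EC; rewrite EC in H1.
have := leq_trans (leq_mul H1 (leqnn (2 ^ (block j + 2)))) H2.
rewrite ET !expnD (_ : 2 ^ 2 = 4) //.
have K0 : 0 < 2 ^ k by rewrite expn_gt0.
have M0 : 0 < 2 ^ block j by rewrite expn_gt0.
move: (cnt _ _) (2 ^ block j) (2 ^ k) H3 M0 K0 => a M K H3 M0 K0.
rewrite leqNgt => /negP; apply.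
rewrite (_ : K * a * (M * 4) = M * (4 * a) * K); last by lia.
by rewrite ltn_pmul2r // ltn_pmul2l //; lia.
Qed.

Theorem theorem3p2 :
  exists U V : nat -> cset,
    universal_ML U /\ ML_test V /\
    exists i : nat, forall j : nat, ~ csubset (V j) (U i).
Proof.
exists (fun i => level_open (univ_test i)), (fun j => level_open (block_test j)); split; [|split].
- split; first by split; [exact: (unif_eff_open_opn cfun_univ_test)|exact: lam_le_univ_test].
  by move=> V HV X HX i; apply: univ_test_universal HV HX.
- by split; [exact: (unif_eff_open_opn cfun_block_test)|exact: lam_le_block_test].
- by exists 0 => j; apply: block_test_not_sub.
Qed.
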